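(* No strict two-stage algorithm for the hypergraph orientation problem has competitive ratio $o(\log n)$, even on instances consisting of a single hyperedge with $n$ vertices and uniform query costs. That is, there is a constant $c>0$ such that for every $n\ge 2$ there is an instance consisting of a single hyperedge on $n$ vertices with uniform query costs on which every strict two-stage algorithm $A$ satisfies $\mathbb E[A]\ge c\log n\cdot\mathbb E[\mathrm{OPT}]$.
   Context: An instance of the hypergraph orientation problem consists of a hypergraph $H=(V,E)$ and, for each vertex $v$, a query cost $c_v$ and a continuous distribution with minimal support interval $I_v$; weights $w_v$ are drawn independently and querying $v$ reveals $w_v$ at cost $c_v$. For a realization, $Q$ is a feasible query set if knowing $w_u$ for $u\in Q$ and only the intervals for unqueried vertices suffices to identify a minimum-weight vertex of every hyperedge; $\mathbb E[\mathrm{OPT}]$ is the expected minimum cost of a feasible query set; $\mathbb E[A]$ is the expected query cost of algorithm $A$. Uniform query costs means $c_v=1$. A strict two-stage algorithm first queries a fixed set $U_1\subseteq V$ (chosen non-adaptively), then queries a set $U_2$ chosen as a function of the revealed weights of $U_1$ (all at once, non-adaptively), and must guarantee that $U_1\cup U_2$ is a feasible query set for every realization. *)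

(* Defs.v *)
From HB Require Import structures.
From mathcomp Require Import all_boot all_order all_algebra.
From mathcomp Require Import all_classical all_reals all_analysis.
Set Implicit Arguments. Unset Strict Implicit. Unset Printing Implicit Defensive.
Import Order.TTheory GRing.Theory Num.Theory.
Local Open Scope classical_set_scope.
Local Open Scope ring_scope.

(* Single hyperedge consisting of all n vertices 'I_n; uniform query costs,
   so the cost of a query set Q is #|Q|. *)

Definition min_support_interval {d} {T : measurableType d} {R : realType}
  (P : probability T R) (Y : {RV P >-> R}) : set R :=
  \bigcap_(i in [set i : interval R | P (Y @^-1` [set` i]) = 1%E]) [set` i].

Definition mutually_independent {d} {T : measurableType d} {R : realType}
  (P : probability T R) (n : nat) (X : 'I_n -> {RV P >-> R}) : Prop :=
  forall B : 'I_n -> set R, (forall i, measurable (B i)) ->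
    P (\bigcap_(i in [set: 'I_n]) (X i @^-1` B i)) =
    (\prod_(i < n) P (X i @^-1` B i))%E.

Definition feasible {R : realType} (n : nat) (I : 'I_n -> set R)
  (w : 'I_n -> R) (Q : {set 'I_n}) : Prop :=
  exists v : 'I_n, forall w' : 'I_n -> R,
    (forall u, u \in Q -> w' u = w u) ->
    (forall u, u \notin Q -> I u (w' u)) ->
    forall u, w' v <= w' u.

Definition OPT {R : realType} (n : nat) (I : 'I_n -> set R) (w : 'I_n -> R) : nat :=
  \big[minn/n]_(Q : {set 'I_n} | `[< feasible I w Q >]) #|Q|.

Definition strict_two_stage {R : realType} (n : nat) (I : 'I_n -> set R)
  (U1 : {set 'I_n}) (U2 : ('I_n -> R) -> {set 'I_n}) : Prop :=
  (forall w w' : 'I_n -> R, (forall u, u \in U1 -> w u = w' u) -> U2 w = U2 w') /\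
  (forall w : 'I_n -> R, (forall u, I u (w u)) -> feasible I w (U1 :|: U2 w)).

(* Main.v *)
Require Import Defs.
From HB Require Import structures.
From mathcomp Require Import all_boot all_order all_algebra.
From mathcomp Require Import all_classical all_reals all_analysis.
From mathcomp Require Import measurable_realfun.
From mathcomp Require Import lra.
Import Order.TTheory GRing.Theory Num.Theory.
Local Open Scope classical_set_scope.
Local Open Scope ring_scope.

(* Vertex i takes, with probability 1/2 each, a "low" value uniform on (i, i+1)
   or a "high" value uniform on (n, n+1), so its interval is (i, n+1). A low
   value at i beats every vertex after i without querying it, so OPT queries
   the vertices up to the first low one: a geometric number, of mean below 2.
   A first stage U1 of size k sees only high values with probability 2^-k; the
   unqueried vertices may then be high as well, which forces querying all n.
   Hence the cost is at least k and at least n 2^-k in expectation, while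
   ln n <= k + n 2^-k. *)

(** * Nested intervals and their feasible query sets *)

Definition nested_itv {R : realType} (n i : nat) : set R :=
  `]i%:R, n.+1%:R[%classic.

Definition two_blocks {R : realType} (n i : nat) : set R :=
  `]i%:R, i.+1%:R[ `|` `]n%:R, n.+1%:R[.

(* The vertices not preceded by a low one; the unique minimal feasible set
   when all weights lie in their blocks. *)
Definition frontier {R : realType} {n : nat} (w : 'I_n -> R) : {set 'I_n} :=
  [set k : 'I_n | [forall i : 'I_n, (i < k)%N ==> (n%:R <= w i)]]%SET.

Lemma sub_two_blocks {R : realType} (n i : nat) : (i < n)%N ->
  @two_blocks R n i `<=` nested_itv n i.
Proof.
move=> ilen x; rewrite /two_blocks /nested_itv /= !in_itv/= => -[] /andP[h1 h2].
  by rewrite h1 (lt_le_trans h2)// ler_nat ltnW.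
by rewrite h2 andbT (le_lt_trans _ h1)// ler_nat ltnW.
Qed.

(** An unqueried [k] is harmless only if the chosen vertex has weight at most the left endpoint [k],
    and only a low weight before [k] is that small. For [n = 1] the empty set would be feasible,
    whence [2 <= n]. *)
Lemma feasibleP {R : realType} (n : nat) (w : 'I_n -> R) (Q : {set 'I_n}) :
  (2 <= n)%N -> (forall i : 'I_n, two_blocks n (nat_of_ord i) (w i)) ->
  feasible (fun i : 'I_n => nested_itv n i) w Q <-> frontier w \subset Q.
Proof.
move=> n2 ww; have wI (i : 'I_n) : nested_itv n i (w i).
  exact: sub_two_blocks (ww i).
split.
  move=> [v hv].
  (* An unqueried v could be pushed above any other vertex, since all intervals
     share their right endpoint. *)
  have vQ : v \in Q.
    apply/negPn/negP => vQ.
    have [z zv] : exists z : 'I_n, z != v.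
      have n0 : (0 < n)%N by exact: ltnW.
      have [v0|v0] := eqVneq (nat_of_ord v) 0%N.
        by exists (Ordinal n2); rewrite -val_eqE/= v0.
      by exists (Ordinal n0); rewrite -val_eqE/= eq_sym.
    pose m := Num.max (w v) (w z).
    pose w' u := if u == v then (m + n.+1%:R) / 2 else w u.
    have hm : m < n.+1%:R.
      by move: (wI v) (wI z); rewrite /nested_itv/= !in_itv/= gt_max => /andP[_ ->] /andP[_ ->].
    have vm : w v <= m by rewrite le_max lexx.
    have zm : w z <= m by rewrite le_max lexx orbT.
    suff : w' v <= w' z.
      by rewrite /w' eqxx (negbTE zv); lra.
    apply: hv => u.
      by rewrite /w'; case: eqVneq => // ->; rewrite (negbTE vQ).
    move=> _; rewrite /w'; case: eqVneq => // ->.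
    by have := wI v; rewrite /nested_itv/= !in_itv/= => /andP[? ?]; apply/andP; split; lra.
  apply/fintype.subsetP => k; rewrite inE => /forallP hk.
  apply/negPn/negP => kQ.
  (* An unqueried k could take any value close to k. *)
  have wvk : w v <= k%:R.
    rewrite leNgt; apply/negP => kv.
    have kn : k%:R < n.+1%:R :> R by rewrite ltr_nat ltnS ltnW.
    have wvn : w v < n.+1%:R.
      have := wI v; rewrite /nested_itv/= !in_itv/=. by move=> /andP[].
    pose w' u := if u == k then (k%:R + w v) / 2 else w u.
    have kv' : v != k by apply: contraNneq kQ => <-.
    suff : w' v <= w' k.
      by rewrite /w' eqxx (negbTE kv'); lra.
    apply: hv => u.
      by rewrite /w'; case: eqVneq => // ->; rewrite (negbTE kQ).
    move=> _; rewrite /w'; case: eqVneq => // ->.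
    by rewrite /nested_itv/= !in_itv/=; apply/andP; split; lra.
  (* From [v < w v <= k], vertex [v] precedes [k], so [w v] is high because [k] is in the frontier;
     this contradicts [w v <= k < n]. *)
  have vk : (v < k)%N.
    have := wI v; rewrite /nested_itv/= !in_itv/= => /andP[h _].
    by rewrite -(ltr_nat R); apply: lt_le_trans wvk.
  have := hk v; rewrite vk/= => nv.
  have : n%:R <= k%:R :> R by exact: le_trans wvk.
  by rewrite ler_nat leqNgt ltn_ord.
move=> KQ.
have n0 : (0 < n)%N by exact: ltnW.
have K0 : Ordinal n0 \in frontier w by rewrite inE; apply/forallP.
(* The answer is a lightest frontier vertex, whose weight is known since the frontier is queried. *)
case: (@arg_minP _ _ _ (Ordinal n0) (fun i => i \in frontier w) w K0) => v vK vmin.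
exists v => w' w'Q w'I u.
rewrite (w'Q v) ?(fintype.subsetP KQ)//.
have [uK|uK] := boolP (u \in frontier w).
  by rewrite (w'Q u) ?(fintype.subsetP KQ)// vmin.
have w'u : u%:R < w' u.
  have [uQ|uQ] := boolP (u \in Q).
    by rewrite w'Q//; have := wI u; rewrite /nested_itv/= in_itv/= => /andP[].
  by have := w'I _ uQ; rewrite /nested_itv/= in_itv/= => /andP[].
(* Outside the frontier, [u] comes after the first low vertex [i], which is itself in the frontier;
   then [w v <= w i < i.+1 <= u < w' u]. *)
move: uK; rewrite inE negb_forall => /existsP[i0].
rewrite negb_imply -ltNge => /andP[i0u wi0].
case: (@arg_minP _ _ _ i0 (fun i : 'I_n => w i < n%:R) (@nat_of_ord n) wi0) => i wi imin.
have iK : i \in frontier w.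
  rewrite inE; apply/forallP => j; apply/implyP => ji.
  by rewrite leNgt; apply/negP => /imin; rewrite leEnat leqNgt ji.
have iu : (i.+1 <= u)%N by apply: leq_ltn_trans i0u; exact: imin.
apply: (le_trans (vmin _ iK)); apply/ltW/(le_lt_trans _ w'u).
apply: (@le_trans _ _ i.+1%:R); last by rewrite ler_nat.
have := ww i; rewrite /two_blocks/= !in_itv/= => -[/andP[_ /ltW]//|/andP[h _]].
by move: (lt_trans h wi); rewrite ltxx.
Qed.

Lemma OPT_frontier {R : realType} (n : nat) (w : 'I_n -> R) :
  (2 <= n)%N -> (forall i : 'I_n, two_blocks n (nat_of_ord i) (w i)) ->
  OPT (fun i : 'I_n => nested_itv n i) w = #|frontier w|.
Proof.
move=> n2 ww; apply/eqP; rewrite eqn_leq; apply/andP; split.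
  rewrite /OPT -minEnat -leEnat; apply: bigmin_le_cond.
  by apply/asboolP/feasibleP.
rewrite /OPT; apply: (big_ind (fun m => #|frontier w| <= m)%N).
(* This case is the default value [n] of the minimum. *)
- by rewrite -[leqRHS]card_ord max_card.
- by move=> a b ha hb; rewrite leq_min ha.
- by move=> Q /asboolP/feasibleP => /(_ n2 ww) /subset_leq_card.
Qed.

Lemma strict_two_stage_high {R : realType} (n : nat) (U1 : {set 'I_n})
    (U2 : ('I_n -> R) -> {set 'I_n}) (w : 'I_n -> R) :
  (2 <= n)%N -> strict_two_stage (fun i : 'I_n => nested_itv n i) U1 U2 ->
  (forall i : 'I_n, two_blocks n (nat_of_ord i) (w i)) -> (forall i, i \in U1 -> n%:R <= w i) ->
  #|U1 :|: U2 w| = n.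
Proof.
move=> n2 [U2det U2feas] ww wU1.
(* U2 cannot tell w from w', which is high everywhere. *)
pose w' i : R := if i \in U1 then w i else n%:R + 2^-1.
have w'ge i : n%:R <= w' i.
  by rewrite /w'; case: ifPn => [/wU1//|_]; lra.
have ww' i : two_blocks n (nat_of_ord i) (w' i).
  rewrite /w'; case: ifPn => // _; right => /=; rewrite in_itv/= -[n.+1%:R]natr1.
  by apply/andP; split; lra.
have -> : U2 w = U2 w' by apply: U2det => u uU; rewrite /w' uU.
have /feasibleP : feasible (fun i : 'I_n => nested_itv n i) w' (U1 :|: U2 w').
  by apply: U2feas => u; exact: sub_two_blocks (ww' u).
move=> /(_ n2 ww') Ksub.
suff -> : U1 :|: U2 w' = [set: 'I_n]%SET by rewrite cardsT card_ord.
apply/eqP; rewrite -finset.subTset; apply: fintype.subset_trans Ksub.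
by apply/fintype.subsetP => i _; rewrite inE; apply/forallP => j; rewrite w'ge implybT.
Qed.

(** * Independent weights with prescribed laws *)

(** Iterated binary products: each step adds a factor on the left, read by index 0, while the older
    variables read the second factor. Independence is then the product formula on rectangles. *)
Lemma independent_copies {R : realType} (n : nat)
    (mu : 'I_n -> probability (measurableTypeR R) R) :
  exists (d : measure_display) (T : measurableType d) (P : probability T R)
         (Z : 'I_n -> T -> R),
    [/\ forall i, measurable_fun [set: T] (Z i),
    forall i B, measurable B -> P (Z i @^-1` B) = mu i B &
    forall B : 'I_n -> set R, (forall i, measurable (B i)) ->
    P (\bigcap_(i in [set: 'I_n]) (Z i @^-1` B i)) =
    (\prod_(i < n) mu i (B i))%E].
Proof.
elim: n mu => [|n IH] mu.
  exists default_measure_display, unit, (dirac tt), (fun _ => cst 0).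
  split=> [[]//|[]//|B mB]; rewrite big_ord0.
  rewrite (_ : \bigcap_(i in _) _ = setT) ?probability_setT//.
  by apply/seteqP; split=> // t _ [].
have [d [T [P [Z [mZ PZ indep]]]]] := IH (fun i => mu (lift ord0 i)).
pose P' : probability (measurableTypeR R * T)%type R := (mu ord0 \x P)%E.
pose Z' i (t : measurableTypeR R * T) : R :=
  if unlift ord0 i is Some j then Z j t.2 else t.1.
have mZ' i : measurable_fun setT (Z' i).
  rewrite /Z'; case: unliftP => [j|] _; last exact: measurable_fst.
  by apply: measurableT_comp => //; exact: measurable_snd.
have Z0 : Z' ord0 = fst by apply/funext => t; rewrite /Z' unlift_none.
have ZS j : Z' (lift ord0 j) = Z j \o snd.
  by apply/funext => t; rewrite /Z' liftK.
exists _, (measurableTypeR R * T)%type, P', Z'; split => //.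
- move=> i B mB; case: (unliftP ord0 i) => [j|] ->.
    rewrite ZS; have -> : (Z j \o snd) @^-1` B = [set: R] `*` (Z j @^-1` B).
      by apply/seteqP; split=> [[x t]//|[x t] []//].
    rewrite [LHS]product_measure1E//; last first.
      by rewrite -[X in measurable X]setTI; exact: mZ.
    by rewrite [X in (X * _)%E]probability_setT mul1e; exact: PZ.
  rewrite Z0; have -> : fst @^-1` B = B `*` [set: T].
    by apply/seteqP; split=> [[x t]//|[x t] []//].
  rewrite [LHS]product_measure1E//.
  by rewrite [X in (_ * X)%E]probability_setT mule1.
move=> B mB.
have -> : \bigcap_(i in [set: 'I_n.+1]) (Z' i @^-1` B i) =
    B ord0 `*` \bigcap_(j in [set: 'I_n]) (Z j @^-1` B (lift ord0 j)).
  apply/seteqP; split=> [[x t] h|[x t] [h0 h] i _].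
    split; first by have := h ord0 Logic.I; rewrite Z0.
    by move=> j _; have := h (lift ord0 j) Logic.I; rewrite ZS.
  by case: (unliftP ord0 i) => [j|] ->; rewrite ?ZS ?Z0//; exact: h.
rewrite big_ord_recl /= -(indep (fun j => B (lift ord0 j)))//.
apply: product_measure1E; first exact: mB.
apply: fin_bigcap_measurable => // j _.
by rewrite -[X in measurable X]setTI; exact: mZ.
Qed.

Lemma measurable_two_blocks {R : realType} (n i : nat) :
  measurable (@two_blocks R n i).
Proof. by apply: measurableU; exact: measurable_itv. Qed.

Lemma lebesgue_unit_itv {R : realType} (a : nat) :
  lebesgue_measure (`]a%:R, a.+1%:R[%classic : set R) = 1%E.
Proof.
rewrite lebesgue_measure_itv/= lte_fin ltr_nat ltnSn.
by rewrite -EFinD -natr1 addrAC subrr add0r.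
Qed.

Lemma lebesgue_two_blocks {R : realType} (n i : nat) : (i < n)%N ->
  lebesgue_measure (@two_blocks R n i) = 2%:E.
Proof.
move=> iln; rewrite measureU; [|exact: measurable_itv|exact: measurable_itv|].
  by rewrite /= !lebesgue_unit_itv -EFinD.
rewrite -subset0 => x [] /=; rewrite !in_itv/= => /andP[_ h1] /andP[h2 _].
have : n%:R < i.+1%:R :> R by exact: lt_trans h1.
by rewrite ltr_nat ltnS leqNgt iln.
Qed.

Lemma probability_of_measure {R : realType}
    (mu : {measure set (measurableTypeR R) -> \bar R}) :
  mu setT = 1%E ->
  exists P : probability (measurableTypeR R) R, forall B, P B = mu B.
Proof.
(* [mnormalize] supplies the probability structure; dividing by mass 1 changes nothing, and the
   Dirac measure is its fallback for mass zero or infinity. *)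
move=> mu1; exists (mnormalize mu (dirac (0 : measurableTypeR R) : probability _ R)) => B.
by rewrite /= /mnormalize mu1 onee_eq0/= invr1 mule1.
Qed.

Lemma block_probability {R : realType} (n i : nat) : (i < n)%N ->
  exists P : probability (measurableTypeR R) R,
    forall B, P B = (2^-1%:E * lebesgue_measure (B `&` two_blocks n i))%E.
Proof.
move=> iln; have half_ge0 : 0 <= 2^-1 :> R by rewrite invr_ge0.
pose m : {measure set (measurableTypeR R) -> \bar R} :=
  mscale (NngNum half_ge0)
    (mrestr lebesgue_measure (@measurable_two_blocks R n i)).
have [|P Pm] := probability_of_measure m; last by exists P.
rewrite /m /= /mscale /= /mrestr setTI lebesgue_two_blocks//.
by rewrite -EFinM mulVf.
Qed.

(** Density 1/2 on two disjoint unit intervals: the even mixture of the uniform laws on the low and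
    the high block. *)
Definition block_law {R : realType} {n : nat} {d} {T : measurableType d}
    (P : probability T R) (X : 'I_n -> T -> R) : Prop :=
  forall (i : 'I_n) B, measurable B ->
    P (X i @^-1` B) = (2^-1%:E * lebesgue_measure (B `&` two_blocks n i))%E.

Lemma nested_instance {R : realType} (n : nat) :
  exists (d : measure_display) (T : measurableType d) (P : probability T R)
         (X : 'I_n -> {RV P >-> R}),
    [/\ mutually_independent X, forall (i : 'I_n) t, two_blocks n i (X i t)
      & block_law P X].
Proof.
have /choice[mu muE] := fun i : 'I_n => @block_probability R n i (ltn_ord i).
have [d [T [P [Z [mZ PZ indep]]]]] := independent_copies n mu.
(* Redefining Z i on a null set makes the block condition hold everywhere,
   not just almost surely. *)
pose g (i : 'I_n) (x : R) : R :=
  if x \in two_blocks n i then x else i%:R + 2^-1.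
have mg i : measurable_fun [set: R] (g i).
  apply: measurable_fun_ifT => //; apply: (measurable_fun_bool true).
  rewrite setTI (_ : _ @^-1` _ = two_blocks n i).
    exact: measurable_two_blocks.
  by apply/seteqP; split=> x; [exact: set_mem|exact: mem_set].
have gA (i : 'I_n) x : two_blocks n i (g i x).
  rewrite /g; case: ifPn => [|_]; first exact: set_mem.
  by left => /=; rewrite in_itv/= -[i.+1%:R]natr1; apply/andP; split; lra.
have gE (i : 'I_n) B : (g i @^-1` B) `&` two_blocks n i = B `&` two_blocks n i.
  apply/seteqP; split=> x [xB xA]; split => //.
    by move: xB; rewrite /= /g mem_set.
  by rewrite /= /g mem_set.
have mgB (i : 'I_n) B : measurable B -> measurable (g i @^-1` B).
  by move=> mB; rewrite -[X in measurable X]setTI; exact: mg.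
have mX i : measurable_fun [set: T] (g i \o Z i) by exact: measurableT_comp.
exists d, T, P, (fun i => mfun_Sub (mem_set (mX i))).
have lawX (i : 'I_n) B : measurable B ->
    P ((g i \o Z i) @^-1` B) = mu i (g i @^-1` B).
  by move=> mB; rewrite comp_preimage PZ//; exact: mgB.
split => //.
- move=> B mB; under [RHS]eq_bigr do rewrite lawX//.
  by rewrite -indep// => i; exact: mgB.
- by move=> i t; exact: gA.
- by move=> i B mB; rewrite [LHS]lawX// muE gE.
Qed.

(** * Support intervals and the probability of high weights *)

(** An interval of full probability has points arbitrarily close to both ends [i] and [n.+1]; by
    convexity it also covers the gap between the blocks. *)
Lemma min_support_nested {R : realType} {n : nat} {d} {T : measurableType d}
    (P : probability T R) (X : 'I_n -> {RV P >-> R}) (i : 'I_n) :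
  block_law P X -> min_support_interval (X i) = nested_itv n i.
Proof.
move=> law; apply/seteqP; split.
  move=> x xI; apply: (xI `]i%:R, n.+1%:R[) => /=.
  rewrite law; last exact: measurable_itv.
  rewrite setIidr; last exact: sub_two_blocks.
  by rewrite lebesgue_two_blocks// -EFinM mulVf.
move=> x; rewrite /nested_itv/= in_itv/= => /andP[ix xn] J /= PJ.
(* Otherwise [J] and []a, b[] would give disjoint events of probabilities 1 and
   [(b - a) / 2 > 0]. *)
have meets (a b : R) : a < b -> `]a, b[ `<=` @two_blocks R n i ->
    exists2 y, [set` J] y & a < y < b.
  move=> ab abA; apply: contrapT => nex.
  have mJ : measurable [set` J] by exact: measurable_itv.
  have mab : measurable `]a, b[%classic by exact: measurable_itv.
  have mXi (B : set R) : measurable B -> measurable (X i @^-1` B).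
    by move=> mB; rewrite -[X in measurable X]setTI; exact: measurable_funP.
  have : (P (X i @^-1` [set` J]) + P (X i @^-1` `]a, b[) <= 1)%E.
    rewrite -measureU; [|exact: mXi|exact: mXi|].
      by apply: probability_le1; apply: measurableU; exact: mXi.
    rewrite -preimage_setI -subset0 => t [tJ /=]; rewrite in_itv/= => tab.
    by apply: nex; exists (X i t).
  rewrite PJ law// setIidl// lebesgue_measure_itv/= lte_fin ab.
  by rewrite -EFinB -EFinM -EFinD lee_fin; lra.
(* Points of [J] on either side of [x]: [y1] from the low block, [y2] from the high one. *)
have [y1 Jy1 /andP[_ y1x]] : exists2 y, [set` J] y & i%:R < y < Num.min x i.+1%:R.
  apply: meets; first by rewrite lt_min ix ltr_nat ltnSn.
  by move=> y /=; rewrite in_itv/= lt_min => /and3P[h1 h2 h3]; left; rewrite /= in_itv/= h1.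
have [y2 Jy2 /andP[xy2 _]] : exists2 y, [set` J] y & Num.max x n%:R < y < n.+1%:R.
  apply: meets; first by rewrite gt_max xn ltr_nat ltnSn.
  by move=> y /=; rewrite in_itv/= gt_max => /andP[/andP[h1 h2] h3]; right; rewrite /= in_itv/= h2.
apply: (interval_is_interval Jy1 Jy2).
by move: y1x xy2; rewrite lt_min gt_max => /andP[/ltW -> _] /andP[/ltW -> _].
Qed.

Lemma prob_all_high {R : realType} {n : nat} {d} {T : measurableType d}
    (P : probability T R) (X : 'I_n -> {RV P >-> R}) (U : {set 'I_n}) :
  mutually_independent X -> block_law P X ->
  P [set t | forall i, i \in U -> n%:R <= X i t] = (2^-1 ^+ #|U|)%:E.
Proof.
move=> indep law.
(* Vertices outside [U] get the sure event and contribute a factor 1. *)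
pose B (i : 'I_n) : set R := if i \in U then `[n%:R, +oo[%classic else setT.
have mB i : measurable (B i).
  by rewrite /B; case: ifP => _; [exact: measurable_itv|].
have -> : [set t | forall i, i \in U -> n%:R <= X i t] =
    \bigcap_(i in [set: 'I_n]) (X i @^-1` B i).
  apply/seteqP; split => t /= h i.
    by move=> _; rewrite /= /B; case: ifPn => // /h; rewrite /= in_itv/= andbT.
  by move=> iU; have := h i Logic.I; rewrite /= /B iU /= in_itv/= andbT.
rewrite indep//.
rewrite (eq_bigr (fun i => (if i \in U then 2^-1 else 1 : R)%:E)) => [|i _].
  by rewrite prodEFin -big_mkcond/= prodr_const.
rewrite /B; case: ifPn => _; last by rewrite preimage_setT probability_setT.
rewrite law; last exact: measurable_itv.
(* The ray from [n] misses the low block since [i.+1 <= n]. *)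
rewrite (_ : _ `&` _ = `]n%:R, n.+1%:R[%classic); last first.
  apply/seteqP; split => x /=; rewrite !in_itv/=.
    move=> [nx [|]]; rewrite /= !in_itv/= => /andP[h1 h2]; last by rewrite h1.
    have : n%:R < i.+1%:R :> R by apply: le_lt_trans h2; move: nx; rewrite andbT.
    by rewrite ltr_nat ltnS leqNgt ltn_ord.
  move=> /andP[h1 h2]; split; first by rewrite ltW.
  by right; rewrite /= in_itv/= h1.
by rewrite lebesgue_unit_itv mule1.
Qed.

(** * Measurability of costs and elementary estimates *)

(** Serves to make the algorithm's cost measurable from the measurable fibres of its second-stage
    set. *)
Lemma measurable_fun_through_fin {d} {T : measurableType d} {R : realType}
    {F : finType} (g : T -> F) (h : F -> R) :
  (forall x, measurable [set t | g t = x]) ->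
  measurable_fun [set: T] (fun t => h (g t)).
Proof.
move=> mg _ B mB; rewrite setTI.
rewrite (_ : _ @^-1` _ =
    \bigcup_(x in [set x | B (h x)]) [set t | g t = x]); last first.
  apply/seteqP; split=> [t tB|t [x xB]]; first by exists (g t).
  by rewrite /= => ->.
by apply: fin_bigcup_measurable => // x _; exact: mg.
Qed.

(** Split [ln n = ln (n / 2^k) + k ln 2] and use [ln x <= x] and [ln 2 <= 1]. *)
Lemma ln_nat_le {R : realType} (n k : nat) : (0 < n)%N ->
  ln n%:R <= k%:R + n%:R * 2^-1 ^+ k :> R.
Proof.
move=> n0; have n0' : 0 < n%:R :> R by rewrite ltr0n.
have two_gt0 : 0 < 2 ^+ k :> R by exact: exprn_gt0.
have p0 : 0 < n%:R * 2^-1 ^+ k :> R by rewrite mulr_gt0// exprn_gt0// invr_gt0.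
have -> : ln n%:R = ln (n%:R * 2^-1 ^+ k) + ln 2 *+ k :> R.
  by rewrite -lnXn// -lnM ?posrE// exprVn mulfVK// gt_eqF.
rewrite addrC lerD//; last exact/ltW/ln_sublinear.
rewrite lerMn2r; apply/orP; right.
by apply: (@le_ln1Dx R 1); lra.
Qed.

Lemma sum_half_powers {R : realType} (n : nat) :
  \sum_(k < n) 2^-1 ^+ k = 2 - 2 * 2^-1 ^+ n :> R.
Proof.
elim: n => [|n IH]; first by rewrite big_ord0 expr0 mulr1 subrr.
by rewrite big_ord_recr/= IH exprS; lra.
Qed.

(** * Expected optimum and expected two-stage cost *)

Section nested_instance_costs.
Context {R : realType} {n : nat} {d} {T : measurableType d}.
Context (P : probability T R) (X : 'I_n -> {RV P >-> R}).
Context (X_indep : mutually_independent X) (X_law : block_law P X).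
Context (X_blocks : forall (i : 'I_n) t, two_blocks n i (X i t)).

Let all_high (U : {set 'I_n}) : set T :=
  [set t | forall i, i \in U -> n%:R <= X i t].

Let before (k : 'I_n) : {set 'I_n} := [set i : 'I_n | (i < k)%N]%SET.

Lemma measurable_all_high U : measurable (all_high U).
Proof.
rewrite (_ : all_high U = \bigcap_(i in [set i | i \in U])
    (X i @^-1` `[n%:R, +oo[%classic)).
  apply: fin_bigcap_measurable => // i _.
  by rewrite -[X in measurable X]setTI; apply: measurable_funP => //.
by apply/seteqP; split=> t h i iU; have := h i iU; rewrite /= in_itv/= andbT.
Qed.

Lemma card_before k : #|before k| = k.
Proof.
rewrite cardsE -sum1_card.
by rewrite -(big_ord_widen n (fun=> 1%N) (ltnW (ltn_ord k))) sum1_card card_ord.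
Qed.

(** A sum of indicators yields measurability and, by linearity, the mean: the [k]-th event concerns
    [k] vertices and has probability [2^-k]. *)
Lemma card_frontierE t :
  #|frontier (fun i => X i t)|%:R = \sum_(k < n) \1_(all_high (before k)) t :> R.
Proof.
rewrite -sum1_card natr_sum big_mkcond/=; apply: eq_bigr => k _.
rewrite indicE inE.
have -> : (t \in all_high (before k)) =
    [forall i : 'I_n, (i < k)%N ==> (n%:R <= X i t)].
  apply/idP/forallP => [|h].
    by rewrite inE => h i; apply/implyP => ik; apply: h; rewrite inE.
  by rewrite inE => i; rewrite inE => ik; exact: (implyP (h i)).
by case: ifP.
Qed.

Lemma measurable_card_frontier :
  measurable_fun setT (fun t => #|frontier (fun i => X i t)|%:R : R).
Proof.
under eq_fun do rewrite card_frontierE.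
apply: measurable_sum => k; apply: measurable_indic.
exact: measurable_all_high.
Qed.

Lemma integral_card_frontier :
  (\int[P]_t (#|frontier (fun i => X i t)|%:R)%:E)%E =
  (2 - 2 * 2^-1 ^+ n)%:E.
Proof.
under eq_integral do rewrite card_frontierE -sumEFin.
rewrite ge0_integral_sum//; last first.
  move=> k; apply/measurable_EFinP/measurable_indic.
  exact: measurable_all_high.
rewrite -sum_half_powers -sumEFin; apply: eq_bigr => k _.
rewrite integral_indic//; last exact: measurable_all_high.
rewrite setIT -[in RHS](card_before k).
exact: prob_all_high.
Qed.

Lemma strict_two_stage_cost (U1 : {set 'I_n}) (U2 : ('I_n -> R) -> {set 'I_n}) :
  (2 <= n)%N -> strict_two_stage (fun i : 'I_n => nested_itv n i) U1 U2 ->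
  (forall S : {set 'I_n}, measurable [set t | U2 (fun v => X v t) = S]) ->
  ((ln n%:R / 2)%:E <=
    \int[P]_t (#|U1 :|: U2 (fun v => X v t)|%:R)%:E)%E.
Proof.
move=> n2 A mU2.
have mcost : measurable_fun [set: T]
    (fun t => (#|U1 :|: U2 (fun v => X v t)|%:R : R)%:E).
  apply/measurable_EFinP.
  exact: (measurable_fun_through_fin _
    (fun S : {set 'I_n} => #|U1 :|: S|%:R) mU2).
have mH := measurable_all_high U1.
have cost_U1 : ((#|U1|%:R)%:E <=
    \int[P]_t (#|U1 :|: U2 (fun v => X v t)|%:R)%:E)%E.
  rewrite -[leLHS]mule1 -(probability_setT P) -integral_cst//.
  apply: ge0_le_integral => //= t _.
  by rewrite lee_fin ler_nat subset_leq_card// finset.subsetUl.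
(* The cost dominates [n] times the indicator of [all_high U1], because it equals [n] on that
   event. *)
have cost_high : ((n%:R * 2^-1 ^+ #|U1|)%:E <=
    \int[P]_t (#|U1 :|: U2 (fun v => X v t)|%:R)%:E)%E.
  rewrite EFinM -(prob_all_high _ _ _ X_indep X_law) -[X in P X]setIT.
  rewrite -integral_indic// -ge0_integralZl//; last first.
    exact/measurable_EFinP/measurable_indic.
  apply: ge0_le_integral => //=.
  - apply: measurable_funeM; exact/measurable_EFinP/measurable_indic.
  - move=> t _; rewrite -EFinM lee_fin indicE.
    case: (boolP (t \in _)) => [|_]; last by rewrite mulr0.
    rewrite inE mulr1 => tH.
    by rewrite (strict_two_stage_high _ _ _ _ n2 A _ tH).
have lnle := @ln_nat_le R n #|U1| (ltnW n2).
move: cost_U1 cost_high.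
move: (\int[P]_t _)%E => C hU1 hhigh.
(* The larger of the two lower bounds is at least half their sum, hence at least [ln n / 2]. *)
have [le|/ltW le] := leP (n%:R * 2^-1 ^+ #|U1|) (#|U1|%:R : R).
  by apply: le_trans hU1; rewrite lee_fin; lra.
by apply: le_trans hhigh; rewrite lee_fin; lra.
Qed.

End nested_instance_costs.

(** * The logarithmic lower bound on the ratio *)

Theorem theoremA2 (R : realType) :
  exists c : R, 0 < c /\
  forall n : nat, (2 <= n)%N ->
  exists (d : measure_display) (T : measurableType d) (P : probability T R)
         (X : 'I_n -> {RV P >-> R}),
    mutually_independent X /\
    (forall v, distribution P (X v) `<< (@lebesgue_measure R)) /\
    let I := fun v => min_support_interval (X v) in
    measurable_fun setT (fun t => (OPT I (fun v => X v t))%:R : R) /\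
    (0 < \int[P]_t ((OPT I (fun v => X v t))%:R)%:E)%E /\
    forall (U1 : {set 'I_n}) (U2 : ('I_n -> R) -> {set 'I_n}),
      strict_two_stage I U1 U2 ->
      (forall S : {set 'I_n}, measurable [set t | U2 (fun v => X v t) = S]) ->
      ((c * ln n%:R)%:E * \int[P]_t ((OPT I (fun v => X v t))%:R)%:E
        <= \int[P]_t (#|U1 :|: U2 (fun v => X v t)|%:R)%:E)%E.
Proof.
(* The constant is the cost bound [ln n / 2] divided by 2, which bounds the mean of OPT. *)
exists 4^-1; split=> [|n n2]; first by rewrite invr_gt0.
have [d [T [P [X [indep blocks law]]]]] := @nested_instance R n.
exists d, T, P, X; split=> //; split.
  (* The law is half of Lebesgue measure restricted to the blocks, so Lebesgue-null sets stay
     null. *)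
  move=> v N N0 B mB BN; rewrite [LHS]law//.
  rewrite (_ : lebesgue_measure _ = 0%E) ?mule0//.
  apply: N0; first by apply: measurableI => //; exact: measurable_two_blocks.
  by move=> x [/BN].
move=> I; have -> : I = fun i : 'I_n => nested_itv n i.
  by apply/funext => i; rewrite /I min_support_nested.
have OPTE t : OPT (fun i : 'I_n => nested_itv n i) (fun v => X v t) =
    #|frontier (fun i => X i t)| by exact: OPT_frontier.
split; first by under eq_fun do rewrite OPTE; exact: measurable_card_frontier.
(* The mean of OPT is [2 - 2 * 2^-n]: [h1] makes it positive and [h0] keeps it below 2. *)
have h1 : 2^-1 ^+ n < 1 :> R.
  by have := @exprn_ilt1 R n 2^-1; rewrite -lt0n (ltnW n2) => ->//; lra.
have h0 : 0 < 2^-1 ^+ n :> R by rewrite exprn_gt0// invr_gt0.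
under eq_integral do rewrite OPTE.
rewrite integral_card_frontier//; split; first by rewrite lte_fin; lra.
move=> U1 U2 A mU2.
apply: le_trans (strict_two_stage_cost _ _ indep law blocks _ _ n2 A mU2).
rewrite -EFinM lee_fin.
have ln_ge0 : 0 <= ln n%:R :> R by rewrite ln_ge0// ler1n ltnW.
nra.
Qed.
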